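(* Let $L$ be a vector lattice and let $L_1, L_2$ be two normal sublattices of $L$. Then $L_1 \cap L_2$ is a normal sublattice of $L_2$. Furthermore, the orthogonal complement of $L_1 \cap L_2$ in $L_2$ is $L_1^\perp \cap L_2$, where $L_1^\perp$ denotes the orthogonal complement of $L_1$ in $L$.
   Context: A vector lattice is a real vector space $L$ with a partial order $\leq$ compatible with addition and with multiplication by (nonnegative) scalars, such that $l_1 \vee l_2 := \sup\{l_1,l_2\}$ and $l_1\wedge l_2 := \inf\{l_1,l_2\}$ exist for all $l_1,l_2\in L$. Write $l^+ := l \vee 0$, $l^- := (-l)\vee 0$, $|l| := l^+ + l^-$. Elements $l_1,l_2$ are orthogonal, $l_1 \perp l_2$, if $|l_1|\wedge|l_2| = 0$. A linear subspace $L'\subset L$ is a sublattice of $L$ if $l_1\vee l_2\in L'$ and $l_1\wedge l_2\in L'$ for all $l_1,l_2\in L'$. A sublattice $L'$ of $L$ is normal if (1) for all $l'\in L'$ and $l\in L$, $|l|\leq |l'|$ implies $l\in L'$; and (2) whenever a family $\{l_i\}_{i\in I}\subset L'$ has a supremum in $L$, this supremum belongs to $L'$. For a subset $S\subset L$, the orthogonal complement of $S$ in $L$ is $S^\perp := \{l\in L : l\perp s \text{ for all } s\in S\}$. *)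

(* Defs.v *)
From HB Require Import structures.
From mathcomp Require Import all_boot all_order all_algebra.
From mathcomp Require Import boolp classical_sets reals.

Set Implicit Arguments.
Unset Strict Implicit.
Unset Printing Implicit Defensive.

Import Order.TTheory GRing.Theory Num.Theory.
Local Open Scope classical_set_scope.
Local Open Scope ring_scope.

(* A join of [Order.Lattice] with [GRing.Lmodule] cannot be declared on top of
   MathComp's number hierarchy (Hierarchy-Builder reports a missing join below
   [Num.RealDomain]), so the lattice axioms are stated on [porderZmodType] as
   the existence of binary suprema and infima. *)
HB.mixin Record isVectorLattice (R : realType) L
    of GRing.Lmodule R L & Num.POrderedZmodule L := {
  lev_add2r : forall z x y : L, x <= y -> x + z <= y + z ;
  lev_scale2l : forall (a : R) (x y : L), 0 <= a -> x <= y -> a *: x <= a *: y ;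
  vsup2_exists : forall x y : L, supremums [set x; y] !=set0 ;
  vinf2_exists : forall x y : L, infimums [set x; y] !=set0
}.

#[short(type="vectorLatticeType")]
HB.structure Definition VectorLattice (R : realType) :=
  { L of GRing.Lmodule R L & Num.POrderedZmodule L & isVectorLattice R L }.

Section VectorLatticeDefs.
Context {R : realType} {L : vectorLatticeType R}.
Implicit Types (l : L) (S A : set L).

(* The default value 0 of [supremum] and [infimum] is never used, by
   [vsup2_exists] and [vinf2_exists]. *)
Definition vjoin (l1 l2 : L) : L := supremum 0 [set l1; l2].
Definition vmeet (l1 l2 : L) : L := infimum 0 [set l1; l2].

Definition vpos l : L := vjoin l 0.
Definition vneg l : L := vjoin (- l) 0.
Definition vabs l : L := vpos l + vneg l.

Definition orthogonal_to (l1 l2 : L) : Prop := vmeet (vabs l1) (vabs l2) = 0.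

Definition orthc S : set L := [set l | forall s, S s -> orthogonal_to l s].

Record sublattice A : Prop := {
  sublattice_submod : submod_closed [in A] ;
  sublattice_join : forall l1 l2, A l1 -> A l2 -> A (vjoin l1 l2) ;
  sublattice_meet : forall l1 l2, A l1 -> A l2 -> A (vmeet l1 l2)
}.

Record normal_sublattice A : Prop := {
  normal_is_sublattice :> sublattice A ;
  normal_solid : forall l' l, A l' -> vabs l <= vabs l' -> A l ;
  normal_sup : forall (I : Type) (f : I -> L), (forall i, A (f i)) ->
    forall s, supremums (range f) s -> A s
}.

Fact vjoinP (x y : L) : supremums [set x; y] (vjoin x y).
Proof.
rewrite /vjoin /supremum; case: eqP => [xy0|_]; last first.
  by case: (vsup2_exists x y) => s; exact: xgetI.
have xyx : [set x; y] x by left.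
by rewrite xy0 in xyx.
Qed.

Fact vmeetP (x y : L) : infimums [set x; y] (vmeet x y).
Proof.
rewrite /vmeet /infimum; case: eqP => [xy0|_]; last first.
  by case: (vinf2_exists x y) => s; exact: xgetI.
have xyx : [set x; y] x by left.
by rewrite xy0 in xyx.
Qed.

End VectorLatticeDefs.

(* The vector lattice carried by a sublattice A: the proof of [sublattice A]
   is part of the type so that the instances below can use it. *)
Definition sublattice_type (R : realType) (L : vectorLatticeType R)
  (A : set L) (hA : sublattice A) : Type := A.

Section SublatticeInstances.
Context {R : realType} {L : vectorLatticeType R} (A : set L).
Variable hA : sublattice A.

Fact sublattice_subsemimod : subsemimod_closed [in A].
Proof. exact/GRing.submod_closed_semi/(sublattice_submod hA). Qed.

HB.instance Definition _ := SubChoice.copy (sublattice_type hA) A.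
HB.instance Definition _ := GRing.SubChoice_isSubLmodule.Build R L _
  (sublattice_type hA) sublattice_subsemimod.
HB.instance Definition _ := Order.SubChoice_isSubPOrder.Build ring_display L _
  ring_display (sublattice_type hA).

Fact sublattice_add2r (z x y : sublattice_type hA) :
  x <= y -> x + z <= y + z.
Proof. by rewrite -!Order.le_val !raddfD; exact: lev_add2r. Qed.

Fact sublattice_scale2l (a : R) (x y : sublattice_type hA) :
  0 <= a -> x <= y -> a *: x <= a *: y.
Proof. by rewrite -!Order.le_val !linearZ; exact: lev_scale2l. Qed.

Fact sublattice_sup2_exists (x y : sublattice_type hA) :
  supremums [set x; y] !=set0.
Proof.
have [ub lub] := vjoinP (val x) (val y).
have Axy : vjoin (val x) (val y) \in A.
  by rewrite inE; apply: (sublattice_join hA); apply/set_mem/valP.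
exists (@Sub _ _ (sublattice_type hA) _ Axy); split => [z xyz|z ubz]; rewrite -Order.le_val SubK.
  by apply: ub; case: xyz => ->; [left|right].
by apply: lub => _ [->|->]; rewrite Order.le_val; apply: ubz; [left|right].
Qed.

Fact sublattice_inf2_exists (x y : sublattice_type hA) :
  infimums [set x; y] !=set0.
Proof.
have [lb glb] := vmeetP (val x) (val y).
have Axy : vmeet (val x) (val y) \in A.
  by rewrite inE; apply: (sublattice_meet hA); apply/set_mem/valP.
exists (@Sub _ _ (sublattice_type hA) _ Axy); split => [z xyz|z lbz]; rewrite -Order.le_val SubK.
  by apply: lb; case: xyz => ->; [left|right].
by apply: glb => _ [->|->]; rewrite Order.le_val; apply: lbz; [left|right].
Qed.

HB.instance Definition _ := isVectorLattice.Build R (sublattice_type hA)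
  sublattice_add2r sublattice_scale2l
  sublattice_sup2_exists sublattice_inf2_exists.

End SublatticeInstances.

(* Main.v *)
(** The lattice operations of a sublattice are those of [L], hence so is
    orthogonality. Suprema agree too when [L2] is normal: if [s] is the supremum
    in [L2] of a nonempty family and [u] is an upper bound in [L], then
    [u /\ s] lies between a member of the family and [s], hence in [L2] by
    solidity, so [s <= u /\ s <= u]; a supremum of the empty family is
    a least element, hence [0]. Finally, if [x] in [L2] is orthogonal to
    [L1] inter [L2] and [y] is in [L1], then [m := |x| /\ |y|] lies in both
    sublattices, and [m = |x| /\ m = 0]. *)

Require Import Defs.
From HB Require Import structures.
From mathcomp Require Import all_boot all_order all_algebra.
From mathcomp Require Import boolp classical_sets reals.

Local Open Scope classical_set_scope.
Local Open Scope ring_scope.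

Import Order.TTheory GRing.Theory.

Set Implicit Arguments.
Unset Strict Implicit.

Section VectorLatticeTheory.
Context {R : realType} {L : vectorLatticeType R}.
Implicit Types (x y z : L) (A : set L).

Lemma vjoin_ubl x y : x <= vjoin x y.
Proof. by apply: (vjoinP x y).1; left. Qed.

Lemma vjoin_ubr x y : y <= vjoin x y.
Proof. by apply: (vjoinP x y).1; right. Qed.

Lemma vjoin_lub x y z : x <= z -> y <= z -> vjoin x y <= z.
Proof. by move=> xz yz; apply: (vjoinP x y).2 => _ [->|->]. Qed.

Lemma vmeet_lbl x y : vmeet x y <= x.
Proof. by apply: (vmeetP x y).1; left. Qed.

Lemma vmeet_lbr x y : vmeet x y <= y.
Proof. by apply: (vmeetP x y).1; right. Qed.

Lemma vmeet_glb x y z : z <= x -> z <= y -> z <= vmeet x y.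
Proof. by move=> zx zy; apply: (vmeetP x y).2 => _ [->|->]. Qed.

Lemma vabs_ge0 x : 0 <= vabs x.
Proof.
rewrite -(addr0 0) (le_trans (lev_add2r 0 _ _ (vjoin_ubr x 0))) //.
by rewrite /vabs ![vpos x + _]addrC lev_add2r // vjoin_ubr.
Qed.

Lemma vabs_id x : 0 <= x -> vabs x = x.
Proof.
move=> x0; have Nx0 : - x <= 0 by have := lev_add2r (- x) _ _ x0; rewrite add0r subrr.
have -> : vabs x = x + 0; last by rewrite addr0.
by congr (_ + _); apply/le_anti; rewrite ?vjoin_ubl ?vjoin_ubr vjoin_lub.
Qed.

(** Solidity applies because [vabs] is idempotent, [vabs x] being nonnegative. *)
Lemma normal_vabs A x : normal_sublattice A -> A x -> A (vabs x).
Proof. by move=> hA Ax; apply: (normal_solid hA Ax); rewrite vabs_id // vabs_ge0. Qed.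

Lemma normal_solid_ge0 A x y :
  normal_sublattice A -> A y -> 0 <= x -> x <= y -> A x.
Proof.
move=> hA Ay x0 xy; apply: (normal_solid hA Ay).
by rewrite !vabs_id // (le_trans x0).
Qed.

Lemma sublatticeB A x y : sublattice A -> A x -> A y -> A (x - y).
Proof.
move=> hA Ax Ay; have [_ lin] := sublattice_submod hA.
apply: set_mem; rewrite addrC -scaleN1r.
by apply: lin; rewrite inE.
Qed.

(** Solidity compares absolute values, so it is applied to a difference: [0 <= z - y <= z - x] puts
    [z - y] in [A], and [y = z - (z - y)]. *)
Lemma normal_between A x y z :
  normal_sublattice A -> A x -> A z -> x <= y -> y <= z -> A y.
Proof.
move=> hA Ax Az xy yz; rewrite -[y](subKr z).
apply: (sublatticeB hA Az).
apply: (normal_solid_ge0 hA (y := z - x)).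
- exact: (sublatticeB hA).
- by have := lev_add2r (- y) _ _ yz; rewrite subrr.
- have := lev_add2r (z - x - y) _ _ xy.
  by rewrite [y + _]addrC subrK addrAC [x + _]addrC subrK.
Qed.

Lemma supremums_set0_eq0 x : supremums set0 x -> x = 0.
Proof.
move=> [_ lub]; have lex y : x <= y by apply: lub.
apply/le_anti; rewrite lex /=.
(* Comparing [x] with [x + x] and cancelling [x] yields [0 <= x]. *)
by have := lev_add2r (- x) _ _ (lex (x + x)); rewrite subrr addrK.
Qed.

End VectorLatticeTheory.

Section SublatticeTheory.
Context {R : realType} {L : vectorLatticeType R} {A : set L} (hA : sublattice A).
Implicit Types u v : sublattice_type hA.

Lemma sublattice_valP u : A (val u).
Proof. exact/set_mem/valP. Qed.

Lemma sublattice_lift x : A x -> exists u, val u = x.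
Proof.
by move=> /mem_set Ax; exists (@Sub _ _ (sublattice_type hA) _ Ax); rewrite SubK.
Qed.

(** The join taken in [L] lies in [A], so it lifts to an upper bound [w] of [u] and [v] in the
    sublattice; each join is then below the other by leastness. *)
Lemma val_vjoin u v : val (vjoin u v) = vjoin (val u) (val v).
Proof.
have [w wE] := sublattice_lift (sublattice_join hA (sublattice_valP u) (sublattice_valP v)).
apply/le_anti/andP; split.
  by rewrite -wE Order.le_val; apply: vjoin_lub; rewrite -Order.le_val wE ?vjoin_ubl ?vjoin_ubr.
by apply: vjoin_lub; rewrite Order.le_val ?vjoin_ubl ?vjoin_ubr.
Qed.

Lemma val_vmeet u v : val (vmeet u v) = vmeet (val u) (val v).
Proof.
have [w wE] := sublattice_lift (sublattice_meet hA (sublattice_valP u) (sublattice_valP v)).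
apply/le_anti/andP; split.
  by apply: vmeet_glb; rewrite Order.le_val ?vmeet_lbl ?vmeet_lbr.
by rewrite -wE Order.le_val; apply: vmeet_glb; rewrite -Order.le_val wE ?vmeet_lbl ?vmeet_lbr.
Qed.

Lemma val_vabs u : val (vabs u) = vabs (val u).
Proof. by rewrite raddfD /= !val_vjoin raddfN raddf0. Qed.

Lemma orthogonal_to_val u v : orthogonal_to (val u) (val v) <-> orthogonal_to u v.
Proof.
rewrite /orthogonal_to -!val_vabs -val_vmeet -(raddf0 (val : sublattice_type hA -> L)).
by split=> [/val_inj|->].
Qed.

End SublatticeTheory.

Lemma normal_supremums_val (R : realType) (L : vectorLatticeType R) (A : set L)
    (hA : normal_sublattice A)
    (S : set (sublattice_type hA)) s :
  S !=set0 -> supremums S s -> supremums (val @` S) (val s).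
Proof.
move=> [t St] [ub lub]; split=> [_ [u Su <-]|x ubx].
  by rewrite Order.le_val ub.
(* The bound [x] may lie outside [A], so it cannot be compared with [s] by [lub]. Its meet with
   [val s] can: the member [t] of [S] bounds it from below, and it still dominates [S]. *)
have [w wE] : exists w : sublattice_type hA, val w = vmeet x (val s).
  apply: sublattice_lift; apply: (normal_between hA (x := val t) (z := val s)).
  - exact: sublattice_valP.
  - exact: sublattice_valP.
  - by apply: vmeet_glb; [apply: ubx; exists t|rewrite Order.le_val ub].
  - exact: vmeet_lbr.
apply: (@le_trans _ _ (val w)); last by rewrite wE vmeet_lbl.
rewrite Order.le_val; apply: lub => u Su; rewrite -Order.le_val wE.
by apply: vmeet_glb; [apply: ubx; exists u|rewrite Order.le_val ub].
Qed.

Theorem proposition2p7 (R : realType) (L : vectorLatticeType R)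
    (L1 L2 : set L) (hL1 : normal_sublattice L1) (hL2 : normal_sublattice L2) :
  let L12 : set (sublattice_type hL2) := val @^-1` (L1 `&` L2) in
  normal_sublattice L12 /\ val @` orthc L12 = orthc L1 `&` L2.
Proof.
move=> L12; have L12E u : L12 u <-> L1 (val u).
  by split=> [[]//|L1u]; split=> //; exact: sublattice_valP.
have [L10 L1lin] := sublattice_submod hL1.
split; first split; first split.
- split=> [|a u v]; first by rewrite inE; apply/L12E; rewrite raddf0; exact: set_mem.
  rewrite !inE => /L12E L1u /L12E L1v; apply/L12E; rewrite linearP.
  by apply: set_mem; apply: L1lin; rewrite inE.
- by move=> u v /L12E L1u /L12E L1v; apply/L12E; rewrite val_vjoin; exact: (sublattice_join hL1).
- by move=> u v /L12E L1u /L12E L1v; apply/L12E; rewrite val_vmeet; exact: (sublattice_meet hL1).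
- move=> u v /L12E L1u vu; apply/L12E; apply: (normal_solid hL1 L1u).
  by rewrite -!val_vabs Order.le_val.
- move=> I f L12f s sups; apply/L12E.
  (* The index type [I] may be empty, and then no member of the family is available as a lower
     bound; [s] is 0 in that case. *)
  have [rf0|/set0P rf0] := eqVneq (range f) set0.
    by rewrite rf0 in sups; rewrite (supremums_set0_eq0 sups) raddf0; exact: set_mem.
  apply: (normal_sup hL1 (f := val \o f)) => [i|]; first exact/L12E.
  by have := normal_supremums_val rf0 sups; rewrite image_comp.
apply/seteqP; split=> [_ [u orthu <-]|x [orthx L2x]]; last first.
  have [u uE] := sublattice_lift hL2 L2x.
  exists u => // v /L12E L1v; apply/orthogonal_to_val.
  by rewrite uE; exact: orthx.
split; last exact: sublattice_valP.
move=> y L1y; rewrite /orthogonal_to; set m := vmeet _ _.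
have m0 : 0 <= m by apply: vmeet_glb; exact: vabs_ge0.
have L1m : L1 m.
  by apply: (normal_solid_ge0 hL1 (normal_vabs hL1 L1y)) => //; exact: vmeet_lbr.
have L2m : L2 m.
  apply: (normal_solid_ge0 hL2 (normal_vabs hL2 (sublattice_valP u))) => //.
  exact: vmeet_lbl.
have [v vE] := sublattice_lift hL2 L2m.
(* As [m] lies in both sublattices, [u] is orthogonal to its lift [v]. Since [m] is below
   [vabs (val u)] and below itself, it is below their meet, which is 0. *)
have /orthu/orthogonal_to_val : L12 v by apply/L12E; rewrite vE.
rewrite /orthogonal_to vE (vabs_id m0) => um0.
by apply/le_anti; rewrite m0 -um0 vmeet_glb // vmeet_lbl.
Qed.
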